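(* Let $(R,\alpha)$ be a regular Hom-Lie conformal superalgebra and let $f\in\widetilde C^1_\alpha(R,R_{-1})$ be a Hom-Nijenhuis operator. Then a deformation of $(R,\alpha)$ can be obtained by putting $$\psi_{\lambda,-\partial-\lambda}(a,b)=[a_\lambda b]_N=[f(a)_\lambda b]+[a_\lambda f(b)]-f([a_\lambda b]),\qquad a,b\in R;$$ that is, $\psi$ generates a deformation of $(R,\alpha)$. Furthermore, this deformation is trivial.
   Context: All vector spaces are over $\mathbb{C}$; $|a|\in\mathbb{Z}_2$ is the parity of a homogeneous element, and formulas involving parities are for homogeneous elements and extended linearly. A Hom-Lie conformal superalgebra is a $\mathbb{Z}_2$-graded $\mathbb{C}[\partial]$-module $R=R_{\bar 0}\oplus R_{\bar 1}$ with an even linear endomorphism $\alpha$ with $\alpha\partial=\partial\alpha$ and a $\mathbb{C}$-linear map $R\otimes R\to\mathbb{C}[\lambda]\otimes R$, $a\otimes b\mapsto[a_\lambda b]$, with $[(R_\phi)_\lambda R_\varphi]\subseteq R_{\phi+\varphi}[\lambda]$, such that: (i) $[\partial a_\lambda b]=-\lambda[a_\lambda b]$ and $[a_\lambda\partial b]=(\partial+\lambda)[a_\lambda b]$; (ii) $[a_\lambda b]=-(-1)^{|a||b|}[b_{-\lambda-\partial}a]$ (if $[b_\nu a]=\sum_n\nu^nc_n$ then $[b_{-\lambda-\partial}a]=\sum_n(-\lambda-\partial)^nc_n$); (iii) $[\alpha(a)_\lambda[b_\mu c]]=[[a_\lambda b]_{\lambda+\mu}\alpha(c)]+(-1)^{|a||b|}[\alpha(b)_\mu[a_\lambda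 c]]$. It is regular if $\alpha$ is an algebra isomorphism, i.e. $\alpha$ is bijective and $\alpha([a_\lambda b])=[\alpha(a)_\lambda\alpha(b)]$ for all $a,b\in R$. $R_{-1}$ denotes $R$ with the action $\rho(a)_\lambda b=[\alpha^{-1}(a)_\lambda b]$. An element $f\in\widetilde C^1_\alpha(R,R_{-1})$ (a 1-cochain) is regarded as a linear operator $f:R\to R$, namely a $\mathbb{C}[\partial]$-linear map with $f\alpha=\alpha f$; it is extended to $R[\lambda]$ by $\mathbb{C}[\lambda]$-linearity. An element $\psi\in C^2_\alpha(R,R_{-1})$ (a 2-cochain) is a $\mathbb{C}$-bilinear map $(a,b)\mapsto\psi_{\lambda,\mu}(a,b)\in R[\lambda,\mu]$ with $\psi_{\lambda,\mu}(\partial a,b)=-\lambda\psi_{\lambda,\mu}(a,b)$, $\psi_{\lambda,\mu}(a,\partial b)=-\mu\psi_{\lambda,\mu}(a,b)$, $\psi_{\lambda,\mu}(a,b)=-(-1)^{|a||b|}\psi_{\mu,\lambda}(b,a)$ and $\psi_{\lambda,\mu}(\alpha(a),\alpha(b))=\alpha(\psi_{\lambda,\mu}(a,b))$. For an even $\psi\in C^2_\alpha(R,R_{-1})_{\bar 0}$, consider the $t$-parametrized family of operations $[a_\lambda b]_t=[a_\lambda b]+t\,\psi_{\lambda,-\partial-\lambda}(a,b)$. One says that $\psi$ generates a deformation of $R$ if $(R,[\cdot_\lambda\cdot]_t,\alpha)$ is a Hom-Lie conformal superalgebra. The deformation is trivial if there is a linear operator $g\in\widetilde C^1_\alpha(R,R_{-1})$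 such that, for $T_t=\mathrm{id}+tg$, one has $T_t([a_\lambda b]_t)=[T_t(a)_\lambda T_t(b)]$ for all $a,b\in R$. A linear operator $f\in\widetilde C^1_\alpha(R,R_{-1})$ is a Hom-Nijenhuis operator if $[f(a)_\lambda f(b)]=f([a_\lambda b]_N)$ for all $a,b\in R$, where $[a_\lambda b]_N=[f(a)_\lambda b]+[a_\lambda f(b)]-f([a_\lambda b])$.
   Formalization: The operator f is assumed even (for odd f the bracket [a_λ b]_N can be odd), and the sesquilinearity, skew-symmetry and α-equivariance of 2-cochains are required only modulo ∂+λ+μ, since a strict cochain ψ with the prescribed ψ_{λ,-∂-λ} need not exist. *)

(* Defs.v *)
From HB Require Import structures.
From mathcomp Require Import all_boot all_order all_algebra.
From mathcomp Require Import finmap monalg.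
From mathcomp Require Import complex reals.

Set Implicit Arguments.
Unset Strict Implicit.
Unset Printing Implicit Defensive.

Import GRing.Theory.
Local Open Scope ring_scope.

(* V[lambda] and V[lambda, mu]: finitely supported families of coefficients in
   V, indexed by n (for lambda^n), resp. by (i, j) (for lambda^i mu^j). *)
Notation poly1 V := {malg V[nat]}.
Notation poly2 V := {malg V[(nat * nat)%type]}.

Section Coefficients.
Variables (K : choiceType) (V : zmodType).

Definition mapc (g : V -> V) (p : {malg V[K]}) : {malg V[K]} :=
  \sum_(k <- msupp p) << g p@_k *g k >>.

Definition mapk (h : K -> K) (p : {malg V[K]}) : {malg V[K]} :=
  \sum_(k <- msupp p) << p@_k *g h k >>.

End Coefficients.

Definition mscale (F : fieldType) (K : choiceType) (V : lmodType F)
  (c : F) (p : {malg V[K]}) : {malg V[K]} := mapc ( *:%R c) p.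

Definition mul_X (V : zmodType) : poly1 V -> poly1 V := mapk succn.

Definition mul_lambda (V : zmodType) : poly2 V -> poly2 V :=
  mapk (fun k => (k.1.+1, k.2)).
Definition mul_mu (V : zmodType) : poly2 V -> poly2 V :=
  mapk (fun k => (k.1, k.2.+1)).
Definition swap_vars (V : zmodType) : poly2 V -> poly2 V :=
  mapk (fun k => (k.2, k.1)).

Definition const1 (V : zmodType) (v : V) : poly1 V := << v *g 0%N >>.
Definition const2 (V : zmodType) (v : V) : poly2 V := << v *g (0%N, 0%N) >>.

(* For p = sum_n nu^n c_n, [subst L h p] is sum_n L^n (h c_n): the variable nu
   is replaced by the operator L, applied on the left of the coefficients. *)
Definition subst (V W : zmodType) (L : W -> W) (h : V -> W) (p : poly1 V) : W :=
  \sum_(n <- msupp p) iter n L (h p@_n).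

(* The parity group Z_2 is [bool], with addition [addb]. *)
Record superModule (F : fieldType) := SuperModule {
  carrier :> lmodType F;
  partial : {linear carrier -> carrier};
  part : bool -> submodClosed carrier;
  part_partial : forall i (a : carrier), a \in part i -> partial a \in part i;
  part_sum : forall a : carrier, exists a0 a1 : carrier,
    [/\ a0 \in part false, a1 \in part true & a = a0 + a1];
  part_direct : forall a : carrier,
    a \in part false -> a \in part true -> a = 0
}.
Arguments partial {F}.
Arguments part {F}.

Section HomLieConformal.
Variables (F : fieldType) (R : superModule F).
Implicit Types (alpha f g : {linear R -> R}) (br : R -> R -> poly1 R).
Implicit Types (psi : R -> R -> poly2 R).

Definition koszul (i j : bool) : F := (-1) ^+ (i && j).

Definition even_op (g : R -> R) : Prop :=
  forall i (a : R), a \in part R i -> g a \in part R i.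

Definition neg_X_partial (p : poly1 R) : poly1 R :=
  - mul_X p - mapc (partial R) p.

Record is_hom_lie_conformal alpha br : Prop := {
  hlc_alpha_even : even_op alpha;
  hlc_alpha_partial : forall a, alpha (partial R a) = partial R (alpha a);
  hlc_bilinl : forall c a a' b,
    br (c *: a + a') b = mscale c (br a b) + br a' b;
  hlc_bilinr : forall c a b b',
    br a (c *: b + b') = mscale c (br a b) + br a b';
  hlc_parity : forall i j (a b : R), a \in part R i -> b \in part R j ->
    br a b \is a monalgOver (part R (i (+) j));
  hlc_sesquil : forall a b, br (partial R a) b = - mul_X (br a b);
  hlc_sesquir : forall a b,
    br a (partial R b) = mapc (partial R) (br a b) + mul_X (br a b);
  hlc_skew : forall i j (a b : R), a \in part R i -> b \in part R j ->
    br a b =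
    - mscale (koszul i j) (subst neg_X_partial (@const1 R) (br b a));
  (* the three terms are [alpha(a)_lambda [b_mu c]],
     [[a_lambda b]_(lambda + mu) alpha(c)] and [alpha(b)_mu [a_lambda c]] *)
  hlc_jacobi : forall i j (a b c : R), a \in part R i -> b \in part R j ->
    subst (@mul_mu R)
      (fun v => subst (@mul_lambda R) (@const2 R) (br (alpha a) v)) (br b c) =
    subst (@mul_lambda R)
      (fun v => subst (fun p => mul_lambda p + mul_mu p) (@const2 R)
                  (br v (alpha c))) (br a b)
    + mscale (koszul i j)
        (subst (@mul_lambda R)
          (fun v => subst (@mul_mu R) (@const2 R) (br (alpha b) v)) (br a c))
}.

Definition is_regular alpha br : Prop :=
  bijective alpha /\
  forall a b, mapc alpha (br a b) = br (alpha a) (alpha b).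

Definition cochain1 alpha f : Prop :=
  (forall a, f (partial R a) = partial R (f a)) /\
  (forall a, f (alpha a) = alpha (f a)).

(* Congruence modulo (partial + lambda + mu) R[lambda, mu]. *)
Definition eqmod_total (p q : poly2 R) : Prop :=
  exists r : poly2 R,
    p - q = mapc (partial R) r + mul_lambda r + mul_mu r.

(* The substitution mu := - partial - lambda; it identifies
   R[lambda, mu] / (partial + lambda + mu) R[lambda, mu] with R[lambda]. *)
Definition reduce (p : poly2 R) : poly1 R :=
  \sum_(k <- msupp p)
    iter k.1 (@mul_X R) (iter k.2 neg_X_partial (const1 p@_k)).

(* A 2-cochain enters a bracket only through psi_(lambda, - partial - lambda).
   Accordingly its defining identities are imposed in
   R[lambda, mu] / (partial + lambda + mu) R[lambda, mu]. Requiring them in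
   R[lambda, mu] itself would be strictly more: when R is not projective over
   F[partial], a bracket satisfying the one-variable identities need not be of
   the form psi_(lambda, - partial - lambda) for such a psi. *)
Record cochain2 alpha psi : Prop := {
  c2_bilinl : forall c a a' b,
    psi (c *: a + a') b = mscale c (psi a b) + psi a' b;
  c2_bilinr : forall c a b b',
    psi a (c *: b + b') = mscale c (psi a b) + psi a b';
  c2_sesquil : forall a b,
    eqmod_total (psi (partial R a) b) (- mul_lambda (psi a b));
  c2_sesquir : forall a b,
    eqmod_total (psi a (partial R b)) (- mul_mu (psi a b));
  c2_skew : forall i j (a b : R), a \in part R i -> b \in part R j ->
    eqmod_total (psi a b) (- mscale (koszul i j) (swap_vars (psi b a)));
  c2_alpha : forall a b,
    eqmod_total (psi (alpha a) (alpha b)) (mapc alpha (psi a b))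
}.

Definition even_cochain2 alpha psi : Prop :=
  cochain2 alpha psi /\
  forall i j (a b : R), a \in part R i -> b \in part R j ->
    psi a b \is a monalgOver (part R (i (+) j)).

Definition deformed br psi (t : F) (a b : R) : poly1 R :=
  br a b + mscale t (reduce (psi a b)).

Definition generates_deformation alpha br psi : Prop :=
  forall t : F, is_hom_lie_conformal alpha (deformed br psi t).

Definition trivial_deformation alpha br psi : Prop :=
  exists g : {linear R -> R}, cochain1 alpha g /\
    forall (t : F) (a b : R),
      let T := fun v : R => v + t *: g v in
      mapc T (deformed br psi t a b) = br (T a) (T b).

Definition nijenhuis_bracket br f (a b : R) : poly1 R :=
  br (f a) b + br a (f b) - mapc f (br a b).

Definition hom_nijenhuis alpha br f : Prop :=
  cochain1 alpha f /\
  forall a b, br (f a) (f b) = mapc f (nijenhuis_bracket br f a b).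

End HomLieConformal.

(* Main.v *)
(* Write N for the Nijenhuis bracket and B_t = [.,.] + t N for the deformed one.
   Expanding an iterated bracket of B_t, with the Nijenhuis identity
   f (N (a, b)) = [f a, f b] used in the t^2 term, gives
     J + t (S1 - f J) + t^2 (S2 - f S1 + f (f J)),
   where J is the undeformed iterated bracket of a, b, c, and S1 (resp. S2) is
   the sum of the three iterated brackets with f applied to one (resp. two) of
   the arguments. This expression is linear in J and the same for the three
   terms of the Hom-Jacobi identity, so the identity for B_t follows from the
   undeformed one at a, b, c and at these f-shifted arguments. The remaining
   axioms are linear in the bracket and pass to N because f commutes with
   partial and alpha. Triviality, with g = f, is the Nijenhuis identity
   compared order by order in t. *)

Require Import Defs.
From HB Require Import structures.
From mathcomp Require Import all_boot all_order all_algebra.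
From mathcomp Require Import finmap monalg.
From mathcomp Require Import complex reals boolp.

Set Implicit Arguments.
Unset Strict Implicit.
Unset Printing Implicit Defensive.

Import GRing.Theory.
Local Open Scope ring_scope.

(** * Additive maps, sums over coefficients, and substitution of operators *)

Local Notation is_add g := {morph g : x y / x + y >-> x + y}.

Section AdditiveMaps.
Variables U V : zmodType.

Lemma is_add0 (g : U -> V) : is_add g -> g 0 = 0.
Proof. by move=> gD; apply: (addrI (g 0)); rewrite -gD !addr0. Qed.

Lemma is_addN (g : U -> V) : is_add g -> {morph g : x / - x}.
Proof.
by move=> gD x; apply: (addrI (g x)); rewrite -gD !subrr is_add0.
Qed.

Lemma is_addB (g : U -> V) : is_add g -> {morph g : x y / x - y}.
Proof. by move=> gD x y; rewrite gD is_addN. Qed.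

Lemma is_add_iter (L : V -> V) n : is_add L -> is_add (iter n L).
Proof. by move=> LD x y; elim: n => //= n ->; rewrite LD. Qed.

End AdditiveMaps.

Section CoefficientSums.
Variables (K : choiceType) (V W : zmodType).

(** Terms outside the support vanish because [h k 0 = 0]. The wider range lets sums over the
    differing supports of [p], [q] and [p + q] be compared. *)
Lemma msum_wide (h : K -> V -> W) (p : {malg V[K]}) (d : {fset K}) :
  (forall k, h k 0 = 0) -> (msupp p `<=` d)%fset ->
  \sum_(k <- msupp p) h k p@_k = \sum_(k <- d) h k p@_k.
Proof.
move=> h0 le_d; apply: big_fset_incl => // k _.
by move/mcoeff_outdom=> ->; rewrite h0.
Qed.

Lemma msumD (h : K -> V -> W) : (forall k, is_add (h k)) ->
  is_add (fun p : {malg V[K]} => \sum_(k <- msupp p) h k p@_k).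
Proof.
move=> hD p q; have h0 k : h k 0 = 0 by apply: is_add0.
rewrite (msum_wide h0 (fsubsetUl (msupp p) (msupp q))).
rewrite (msum_wide h0 (fsubsetUr (msupp p) (msupp q))).
rewrite (msum_wide h0 (msuppD_le p q)) -big_split /=.
by apply: eq_bigr => k _; rewrite mcoeffD hD.
Qed.

Lemma msumU (h : K -> V -> W) k v : (forall k, h k 0 = 0) ->
  \sum_(l <- msupp << v *g k >>) h l << v *g k >>@_l = h k v.
Proof.
move=> h0; rewrite (msum_wide h0 msuppU_le).
by rewrite big_seq_fset1 mcoeffUU.
Qed.

(** A family is the sum of its monomials, so identities between additive operators need only be
    checked on monomials. *)
Lemma malg_morph_eq (g1 g2 : {malg V[K]} -> W) : is_add g1 -> is_add g2 ->
  (forall k v, g1 << v *g k >> = g2 << v *g k >>) -> g1 =1 g2.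
Proof.
move=> g1D g2D eqg p; rewrite (monalgE p).
rewrite (big_morph g1 g1D (is_add0 g1D)) (big_morph g2 g2D (is_add0 g2D)).
by apply: eq_bigr => k _.
Qed.

End CoefficientSums.

Section Coefficientwise.
Variables (K : choiceType) (V : zmodType).
Implicit Types (p q : {malg V[K]}) (g : V -> V) (h : K -> K).

Lemma mcoeff_mapc g p k : is_add g -> (mapc g p)@_k = g p@_k.
Proof.
move=> gD; have g0 := is_add0 gD.
rewrite {2}(monalgE p) /mapc.
rewrite (big_morph (mcoeff k) (mcoeffD k) (mcoeff0 k)).
rewrite (big_morph (mcoeff k) (mcoeffD k) (mcoeff0 k)).
rewrite (big_morph g gD g0); apply: eq_bigr => l _.
by rewrite !mcoeffU; case: (l == k); rewrite ?mulr1n ?mulr0n.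
Qed.

Lemma mapcD g : is_add g -> is_add (@mapc K V g).
Proof. by move=> gD p q; apply/malgP=> k; rewrite !(mcoeffD, mcoeff_mapc). Qed.

Lemma mapcU g (k : K) v : is_add g -> mapc g << v *g k >> = << g v *g k >>.
Proof.
move=> gD; apply: (msumU (h := fun (k : K) v => << g v *g k >>)) => l.
by rewrite is_add0 // monalgU0.
Qed.

Lemma mapc_commute g1 g2 p : is_add g1 -> is_add g2 ->
  (forall v, g1 (g2 v) = g2 (g1 v)) ->
  mapc g1 (mapc g2 p) = mapc g2 (mapc g1 p).
Proof. by move=> g1D g2D c12; apply/malgP=> k; rewrite !mcoeff_mapc. Qed.

End Coefficientwise.

Section Reindexing.
Variables (K L : choiceType) (V : zmodType).
Implicit Types (g : V -> V).

(* [mapk] allows no change of index type. *)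
Definition reindex (h : K -> L) (p : {malg V[K]}) : {malg V[L]} :=
  \sum_(k <- msupp p) << p@_k *g h k >>.

Lemma reindexD h : is_add (reindex h).
Proof.
by apply: (msumD (h := fun k v => << v *g h k >>)) => k x y; rewrite monalgUD.
Qed.

Lemma reindexU h k v : reindex h << v *g k >> = << v *g h k >>.
Proof.
by apply: (msumU (h := fun k v => << v *g h k >>)) => l; rewrite monalgU0.
Qed.

Lemma mapc_reindex g h p : is_add g ->
  mapc g (reindex h p) = reindex h (mapc g p).
Proof.
move=> gD; move: p; apply: malg_morph_eq => [p q|p q|k v].
- by rewrite reindexD mapcD.
- by rewrite mapcD // reindexD.
by rewrite reindexU !mapcU // reindexU.
Qed.

End Reindexing.

Section Mapk.
Variables (K : choiceType) (V : zmodType).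

Lemma mapkD (h : K -> K) : is_add (@mapk K V h).
Proof. exact: reindexD. Qed.

Lemma mapkU (h : K -> K) k v :
  mapk h << v *g k >> = << v *g h k >> :> {malg V[K]}.
Proof. exact: reindexU. Qed.

Lemma mapc_mapk (g : V -> V) (h : K -> K) p : is_add g ->
  mapc g (mapk h p) = mapk h (mapc g p).
Proof. exact: mapc_reindex. Qed.

End Mapk.

Section Subst.
Variables V W : zmodType.
Implicit Types (L : W -> W) (h : V -> W) (p : poly1 V).

Lemma substD L h : is_add L -> is_add h -> is_add (subst L h).
Proof.
move=> LD hD; apply: (msumD (h := fun n v => iter n L (h v))) => n x y.
by rewrite hD is_add_iter.
Qed.

Lemma substU L h n v : is_add L -> is_add h ->
  subst L h << v *g n >> = iter n L (h v).
Proof.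
move=> LD hD; apply: (msumU (h := fun n v => iter n L (h v))) => k.
by rewrite (is_add0 hD) (is_add0 (is_add_iter _ LD)).
Qed.

Lemma eq_subst L h1 h2 p : h1 =1 h2 -> subst L h1 p = subst L h2 p.
Proof. by move=> e12; apply: eq_bigr => n _; rewrite e12. Qed.

Lemma subst_addr L h1 h2 p : is_add L ->
  subst L (fun v => h1 v + h2 v) p = subst L h1 p + subst L h2 p.
Proof.
move=> LD; rewrite /subst -big_split; apply: eq_bigr => n _ /=.
exact: is_add_iter.
Qed.

Lemma subst_mapc L h (g : V -> V) p : is_add L -> is_add h -> is_add g ->
  subst L h (mapc g p) = subst L (h \o g) p.
Proof.
move=> LD hD gD; have hgD : is_add (h \o g) by move=> x y /=; rewrite gD hD.
move: p; apply: malg_morph_eq => [p q||n v].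
- by rewrite mapcD // substD.
- exact: substD.
by rewrite mapcU // !substU.
Qed.

Lemma morph_subst (g : W -> W) L h p : is_add g ->
  (forall w, g (L w) = L (g w)) -> g (subst L h p) = subst L (g \o h) p.
Proof.
move=> gD gL; rewrite /subst (big_morph g gD (is_add0 gD)).
apply: eq_bigr => n _ /=; elim: n (h _) => //= n IH w.
by rewrite gL IH.
Qed.

End Subst.

Section Mscale.
Variables (F : fieldType) (K : choiceType) (V : lmodType F).
Implicit Types (p : {malg V[K]}).

Lemma scale_add (c : F) : is_add ( *:%R c : V -> V).
Proof. exact: scalerDr. Qed.

Lemma mcoeff_mscale c p k : (mscale c p)@_k = c *: p@_k.
Proof. by rewrite mcoeff_mapc //; apply: scale_add. Qed.

Lemma mscaleDr c : is_add (@mscale F K V c).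
Proof. by apply: mapcD; apply: scale_add. Qed.

Lemma mscaleA c d p : mscale c (mscale d p) = mscale (c * d) p.
Proof. by apply/malgP=> k; rewrite !mcoeff_mscale scalerA. Qed.

Lemma mscaleC c d p : mscale c (mscale d p) = mscale d (mscale c p).
Proof. by rewrite !mscaleA mulrC. Qed.

Lemma mscale1 p : mscale 1 p = p.
Proof. by apply/malgP=> k; rewrite mcoeff_mscale scale1r. Qed.

Lemma mapc_mscale (g : {linear V -> V}) c p :
  mapc g (mscale c p) = mscale c (mapc g p).
Proof.
by apply: mapc_commute => [x y|x y|v]; rewrite ?scalerDr ?linearD ?linearZ.
Qed.

End Mscale.

(* The value of an iterated bracket deformed by t, with T = t and G = f: here x0
   is the undeformed bracket, and x1 (resp. x2) is the sum of the undeformed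
   brackets with f applied to one (resp. two) of the three arguments. *)
Definition deform_expand (W : zmodType) (T G : W -> W) (x0 x1 x2 : W) : W :=
  x0 + T (x1 - G x0) + T (T (x2 - G x1 + G (G x0))).

(** The expansion is jointly additive in its three entries, and [k], later the scaling by the Koszul
    sign, commutes with [T] and [G]. *)
Lemma deform_expand_combine (W : zmodType) (T G k : W -> W) x0 x1 x2 y0 y1 y2 :
  is_add T -> is_add G -> is_add k ->
  (forall x, T (k x) = k (T x)) -> (forall x, G (k x) = k (G x)) ->
  deform_expand T G (x0 + k y0) (x1 + k y1) (x2 + k y2) =
  deform_expand T G x0 x1 x2 + k (deform_expand T G y0 y1 y2).
Proof.
move=> TD GD kD Tk Gk.
have add_k a b a' b' : a + k b + (a' + k b') = a + a' + k (b + b').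
  by rewrite kD addrACA.
have sub_k a b a' b' : a + k b - (a' + k b') = a - a' + k (b - b').
  by rewrite (is_addB kD) opprD addrACA.
have T_k a b : T (a + k b) = T a + k (T b) by rewrite TD Tk.
have G_k a b : G (a + k b) = G a + k (G b) by rewrite GD Gk.
by rewrite /deform_expand !G_k !sub_k !add_k !T_k !add_k.
Qed.

(** In the use below, [q] is the bracket of [u] with [f] of the inner bracket. It cancels between
    the inner and the outer Nijenhuis brackets, leaving S1 - f J at order t. *)
Lemma is_add_collect (W : zmodType) (g : W -> W) (gD : is_add g) z a b c m q s :
  z + g (b + c - q) + g (a + q - m + g s) = z + g (a + b + c - m) + g (g s).
Proof.
rewrite [g (_ + g s)]gD addrA; congr (_ + _).
rewrite -addrA -gD; congr (_ + g _).
by rewrite addrA [a + q]addrC [_ + (q + a)]addrA subrK [_ + a]addrC !addrA.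
Qed.

(** * Iterated brackets and their expansion in powers of t *)

Section Composition.
Variables (F : fieldType) (V : lmodType F).
Implicit Types (L : poly2 V -> poly2 V) (b : V -> poly1 V) (p : poly1 V).

(** Abstracts multiplication by lambda, mu or lambda + mu, so that one expansion covers all three
    terms of the Hom-Jacobi identity. *)
Definition coef_natural L :=
  is_add L /\
  forall g : V -> V, is_add g -> forall q, mapc g (L q) = L (mapc g q).

Lemma coef_natural_mapk h : coef_natural (mapk h).
Proof. by split=> [|g gD q]; [exact: mapkD | exact: mapc_mapk]. Qed.

Lemma coef_natural_add L1 L2 : coef_natural L1 -> coef_natural L2 ->
  coef_natural (fun q => L1 q + L2 q).
Proof.
case=> L1D L1g [L2D L2g]; split=> [p q|g gD q].
  by rewrite L1D L2D addrACA.
by rewrite mapcD // L1g // L2g.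
Qed.

(* For b = [u_lambda .] and p = [b_mu c] this is the iterated bracket
   [u_lambda [b_mu c]]; L1 and L2 multiply by the variables of the outer
   coefficients p and of the inner brackets b respectively. *)
Definition nest L1 L2 b p : poly2 V :=
  subst L1 (fun v => subst L2 (@const2 V) (b v)) p.

Lemma const2D : is_add (@const2 V).
Proof. exact: monalgUD. Qed.

Variables L1 L2 : poly2 V -> poly2 V.
Hypotheses (nL1 : coef_natural L1) (nL2 : coef_natural L2).
Local Notation nst := (nest L1 L2).

Lemma inner_substD b : is_add b -> is_add (fun v => subst L2 (@const2 V) (b v)).
Proof.
by move=> bD u v; rewrite bD substD //; [case: nL2 | exact: const2D].
Qed.

Lemma nestD b : is_add b -> is_add (nst b).
Proof. by move=> bD; apply: substD; [case: nL1 | exact: inner_substD]. Qed.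

Lemma nest_addb b1 b2 p :
  nst (fun v => b1 v + b2 v) p = nst b1 p + nst b2 p.
Proof.
rewrite -subst_addr; last by case: nL1.
apply: eq_subst => v; apply: substD; first by case: nL2.
exact: const2D.
Qed.

Lemma nest_subb b1 b2 p :
  nst (fun v => b1 v - b2 v) p = nst b1 p - nst b2 p.
Proof.
apply: (addIr (nst b2 p)); rewrite subrK -nest_addb.
by apply: eq_subst => v; rewrite subrK.
Qed.

Lemma nest_comp b g p : is_add b -> is_add g ->
  nst b (mapc g p) = nst (b \o g) p.
Proof.
by move=> bD gD; rewrite /nest subst_mapc //; [case: nL1 | exact: inner_substD].
Qed.

Lemma mapc_nest b g p : is_add g ->
  mapc g (nst b p) = nst (fun v => mapc g (b v)) p.
Proof.
move=> gD; have [L1D L1g] := nL1; have [L2D L2g] := nL2.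
rewrite /nest morph_subst => [|q r|q]; rewrite ?mapcD ?L1g //.
apply: eq_subst => v /=.
rewrite morph_subst => [|q r|q]; rewrite ?mapcD ?L2g // subst_mapc //.
  by apply: eq_subst => w /=; apply: mapcU.
exact: const2D.
Qed.

Lemma nest_mscale b c p : is_add b -> (forall v, b (c *: v) = mscale c (b v)) ->
  nst b (mscale c p) = mscale c (nst b p).
Proof.
move=> bD bZ; rewrite /mscale nest_comp ?mapc_nest //; try exact: scale_add.
by apply: eq_subst => v /=; rewrite bZ.
Qed.

Variables (B : V -> V -> poly1 V) (f : {linear V -> V}).
Hypotheses (BD : forall u, is_add (B u))
  (BZ : forall c u v, B u (c *: v) = mscale c (B u v)).

Let fD : is_add f. Proof. exact: linearD. Qed.

(* The Nijenhuis bracket; it is also applied to the bracket with its arguments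
   flipped, so that one expansion serves both [a [b c]] and [[a b] c]. *)
Definition nij_expand u v := B (f u) v + B u (f v) - mapc f (B u v).

Lemma nij_expandD u : is_add (nij_expand u).
Proof.
move=> v w; rewrite /nij_expand linearD !BD mapcD //.
by rewrite opprD [RHS]addrACA; congr (_ + _); rewrite addrACA.
Qed.

Lemma nij_expandZ u c v : nij_expand u (c *: v) = mscale c (nij_expand u v).
Proof.
by rewrite /nij_expand linearZ /= !BZ mapc_mscale
  (is_addB (mscaleDr c)) mscaleDr.
Qed.

Lemma nest_nij u p :
  nst (nij_expand u) p =
  nst (B (f u)) p + nst (B u) (mapc f p) - mapc f (nst (B u) p).
Proof.
rewrite /nij_expand nest_subb nest_addb nest_comp // mapc_nest //.
Qed.

Hypothesis nij : forall u v, B (f u) (f v) = mapc f (nij_expand u v).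

Lemma nest_nij_image u p :
  nst (B (f u)) (mapc f p) = mapc f (nst (nij_expand u) p).
Proof.
by rewrite mapc_nest // nest_comp //; apply: eq_subst => v /=; rewrite nij.
Qed.

(** This is the t^2 coefficient. Here [p] stands for the inner bracket, [p1] and [p2] for it with
    [f] on one argument, [p12] with [f] on both. The Nijenhuis identity enters twice: as the
    hypothesis on the inner bracket and through [nest_nij_image] on the outer one. *)
Lemma nest_nij_nij u p p1 p2 p12 : mapc f (p1 + p2 - mapc f p) = p12 ->
  nst (nij_expand u) (p1 + p2 - mapc f p) =
  nst (B (f u)) p1 + nst (B (f u)) p2 + nst (B u) p12
  - mapc f (nst (B (f u)) p + nst (B u) p1 + nst (B u) p2)
  + mapc f (mapc f (nst (B u) p)).
Proof.
move=> p12E; rewrite nest_nij p12E.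
have nBD w : is_add (nst (B w)) by apply: nestD.
have nBB w := is_addB (nBD w).
have mfD : is_add (@mapc _ _ f : poly2 V -> _) by apply: mapcD.
have mfB := is_addB mfD.
rewrite !nBB !nBD nest_nij_image nest_nij.
rewrite [X in X - _ = _]addrAC -[LHS]addrA -opprD -mfD.
rewrite -[RHS]addrA -[X in _ = _ + (_ + X)]opprK -opprD -mfB.
congr (_ - _); congr (mapc f _).
(* The term [q], with [f] applied to the whole inner bracket, occurs with both signs and cancels. *)
move: (nst (B (f u)) p) (nst (B u) (mapc f p)) => z q.
move: (mapc f _) (nst _ p1) (nst _ p2) => m a b.
by rewrite [LHS]addrAC [a + b - q]addrC [z + q + _]addrA addrK
  [z + (a + b)]addrA.
Qed.

Lemma nest_deform t u p p1 p2 p12 : mapc f (p1 + p2 - mapc f p) = p12 ->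
  nst (fun v => B u v + mscale t (nij_expand u v))
      (p + mscale t (p1 + p2 - mapc f p)) =
  deform_expand (mscale t) (mapc f) (nst (B u) p)
    (nst (B (f u)) p + nst (B u) p1 + nst (B u) p2)
    (nst (B (f u)) p1 + nst (B (f u)) p2 + nst (B u) p12).
Proof.
move=> p12E; have BuD : is_add (nst (B u)) by apply: nestD.
have nND : is_add (nst (nij_expand u)) by apply/nestD/nij_expandD.
rewrite nest_addb -(mapc_nest _ _ (scale_add t)) -/(mscale t _).
have ZB q := nest_mscale q (BD u) (BZ t u).
have ZN q := nest_mscale q (nij_expandD u) (nij_expandZ u t).
rewrite BuD nND ZB ZN.
rewrite (nest_nij_nij _ p12E) (is_addB BuD) BuD nest_nij.
exact: is_add_collect (mscaleDr t) _ _ _ _ _ _ _.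
Qed.

End Composition.


(** Serves triviality: [r] is [f] of the undeformed bracket, subtracted in the Nijenhuis bracket and
    restored by the t-part of id + t f. *)
Lemma is_add_regroup (W : zmodType) (g : W -> W) (gD : is_add g) x p q r s :
  x + g (p + q - r) + g (r + g s) = x + g q + g (p + g s).
Proof.
by rewrite -addrA -gD addrA subrK [p + q]addrC -addrA gD addrA.
Qed.

(** The given identity is used at seven triples: the original one, three with one argument shifted
    by [f], three with two. Each sum lists its summands as [nest_deform] produces them, outermost
    argument first. [P] and [Q] will be parity conditions. *)
Lemma deform_expand_identity (X : Type) (W : zmodType) (f : X -> X)
    (P Q : X -> Prop) (T G k : W -> W) (J1 J2 J3 : X -> X -> X -> W) :
  is_add T -> is_add G -> is_add k ->
  (forall x, T (k x) = k (T x)) -> (forall x, G (k x) = k (G x)) ->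
  (forall a, P a -> P (f a)) -> (forall b, Q b -> Q (f b)) ->
  (forall a b c, P a -> Q b -> J1 a b c = J2 a b c + k (J3 a b c)) ->
  forall a b c, P a -> Q b ->
  deform_expand T G (J1 a b c)
    (J1 (f a) b c + J1 a (f b) c + J1 a b (f c))
    (J1 (f a) (f b) c + J1 (f a) b (f c) + J1 a (f b) (f c)) =
  deform_expand T G (J2 a b c)
    (J2 a b (f c) + J2 (f a) b c + J2 a (f b) c)
    (J2 (f a) b (f c) + J2 a (f b) (f c) + J2 (f a) (f b) c) +
  k (deform_expand T G (J3 a b c)
      (J3 a (f b) c + J3 (f a) b c + J3 a b (f c))
      (J3 (f a) (f b) c + J3 a (f b) (f c) + J3 (f a) b (f c))).
Proof.
move=> TD GD kD Tk Gk Pf Qf J123 a b c Pa Qb.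
have [Pfa Qfb] := (Pf _ Pa, Qf _ Qb).
have add_k x y x' y' : x + k y + (x' + k y') = x + x' + k (y + y').
  by rewrite kD addrACA.
have rot (x y z : W) : x + y + z = y + z + x by rewrite -addrA addrC.
(* All sums are brought to the order of the [J1] sums, so that they match summand by summand. *)
rewrite [J2 a b (f c) + _ + _]rot [J2 (f a) b (f c) + _ + _]rot.
rewrite [J2 a (f b) (f c) + _ + _]rot.
rewrite [J3 a (f b) c + _]addrC [_ + J3 a (f b) (f c) + _]addrAC.
by rewrite -(deform_expand_combine _ _ _ _ _ _ TD) // !J123 // !add_k.
Qed.

(** * Linearity, parity, sesquilinearity and skew-symmetry of the Nijenhuis bracket *)

Section NijenhuisBracket.
Variables (F : fieldType) (R : superModule F) (alpha f : {linear R -> R}).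
Variable br : R -> R -> poly1 R.
Hypotheses (hR : is_hom_lie_conformal alpha br) (f_even : even_op f).
Hypotheses (f_partial : forall a, f (partial R a) = partial R (f a))
  (f_alpha : forall a, f (alpha a) = alpha (f a)).
Local Notation N := (nijenhuis_bracket br f).

Let fD : is_add f. Proof. exact: linearD. Qed.
Let partialD : is_add (partial R). Proof. exact: linearD. Qed.

Lemma br_addl b : is_add (br^~ b).
Proof. by move=> a a'; rewrite -[a in LHS]scale1r (hlc_bilinl hR) mscale1. Qed.

Lemma br_addr a : is_add (br a).
Proof. by move=> b b'; rewrite -[b in LHS]scale1r (hlc_bilinr hR) mscale1. Qed.

Lemma br_scalel c a b : br (c *: a) b = mscale c (br a b).
Proof.
by rewrite -[c *: a]addr0 (hlc_bilinl hR) (is_add0 (br_addl b)) addr0.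
Qed.

Lemma br_scaler c a b : br a (c *: b) = mscale c (br a b).
Proof.
by rewrite -[c *: b]addr0 (hlc_bilinr hR) (is_add0 (br_addr a)) addr0.
Qed.

(** Flipping the arguments turns results about the second argument into results about the first. *)
Lemma nij_flipE a b : N a b = nij_expand (fun u v => br v u) f b a.
Proof. by congr (_ - _); apply: addrC. Qed.

Lemma nij_bilinl c a a' b : N (c *: a + a') b = mscale c (N a b) + N a' b.
Proof.
rewrite !nij_flipE (nij_expandD f br_addl).
by rewrite (nij_expandZ (B := fun u v => br v u)) // => *; apply: br_scalel.
Qed.

Lemma nij_bilinr c a b b' : N a (c *: b + b') = mscale c (N a b) + N a b'.
Proof.
have NE x y : N x y = nij_expand br f x y by [].
by rewrite !NE (nij_expandD f br_addr) (nij_expandZ f br_scaler).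
Qed.

Lemma nij_parity i j (a b : R) : a \in part R i -> b \in part R j ->
  N a b \is a monalgOver (part R (i (+) j)).
Proof.
move=> ai bj; have [fai fbj] := (f_even ai, f_even bj).
have coef x y k : x \in part R i -> y \in part R j ->
    (br x y)@_k \in part R (i (+) j).
  by move=> xi yj; move: k; apply/monalgOverP; apply: (hlc_parity hR).
apply/monalgOverP => k.
rewrite mcoeffB mcoeffD mcoeff_mapc //; apply: rpredD.
  by apply: rpredD; apply: coef.
(* Negation is treated as scaling by -1, under which the homogeneous parts are closed. *)
by rewrite -scaleN1r; apply: rpredZ; apply: f_even; apply: coef.
Qed.

Definition conformal_linear (g : R -> R) : Prop :=
  [/\ is_add g, forall c a, g (c *: a) = c *: g a
    & forall a, g (partial R a) = partial R (g a)].

(** Sesquilinearity and skew-symmetry equate a bracket with such an operation applied to a bracket.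
    Since [partial] may act on coefficients here, commutation is asked only with maps linear over
    F[partial]; these include both [f] and scalings, so the axioms pass to N and to B_t. *)
Definition natural (op : poly1 R -> poly1 R) : Prop :=
  is_add op /\
  forall g, conformal_linear g -> forall p, mapc g (op p) = op (mapc g p).

Lemma mul_X_natural : natural (@mul_X R).
Proof. by split=> [|g [gD _ _] p]; [exact: mapkD | exact: mapc_mapk]. Qed.

Lemma opp_natural op : natural op -> natural (fun p => - op p).
Proof.
case=> opD opg; split=> [p q|g g_lin p]; first by rewrite opD opprD.
by rewrite (is_addN (mapcD _)) ?opg //; case: g_lin.
Qed.

Lemma add_natural op1 op2 : natural op1 -> natural op2 ->
  natural (fun p => op1 p + op2 p).
Proof.
case=> op1D op1g [op2D op2g]; split=> [p q|g g_lin p].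
  by rewrite op1D op2D addrACA.
by have [gD _ _] := g_lin; rewrite (mapcD gD) op1g // op2g.
Qed.

Lemma partial_natural : natural (mapc (partial R)).
Proof.
split=> [|g [gD _ gp] p]; first exact: mapcD.
exact: mapc_commute.
Qed.

Lemma neg_X_partial_natural : natural (@neg_X_partial F R).
Proof.
have := add_natural (opp_natural mul_X_natural) (opp_natural partial_natural).
exact.
Qed.

Lemma subst_natural : natural (subst (@neg_X_partial F R) (@const1 R)).
Proof.
have [nD ng] := neg_X_partial_natural.
have cD : is_add (@const1 R) by exact: monalgUD.
split=> [|g g_lin p]; first exact: substD.
have [gD _ _] := g_lin.
rewrite morph_subst => [||q]; [|exact: mapcD|exact: ng].
by rewrite subst_mapc //; apply: eq_subst => v /=; apply: mapcU.
Qed.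

Lemma mscale_natural c op : natural op -> natural (fun p => mscale c (op p)).
Proof.
case=> opD opg; split=> [p q|g g_lin p]; first by rewrite opD mscaleDr.
have [gD gZ _] := g_lin; rewrite -opg //.
apply: mapc_commute => //; exact: scale_add.
Qed.

Lemma f_conformal : conformal_linear f.
Proof. by split=> // c a; rewrite linearZ. Qed.

Lemma scale_conformal t : conformal_linear ( *:%R t).
Proof.
split=> [|c a|a]; first exact: scale_add; last by rewrite linearZ.
by rewrite !scalerA mulrC.
Qed.

Lemma nij_op op p q r : natural op ->
  op p + op q - mapc f (op r) = op (p + q - mapc f r).
Proof.
by case=> opD opg; rewrite (is_addB opD) opD (opg _ f_conformal).
Qed.

Lemma deform_op op t p q : natural op ->
  op p + mscale t (op q) = op (p + mscale t q).
Proof.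
by case=> opD opg; rewrite opD /mscale (opg _ (scale_conformal t)).
Qed.

Definition skew_op i j (p : poly1 R) : poly1 R :=
  - mscale (koszul F i j) (subst (@neg_X_partial F R) (@const1 R) p).

Lemma skew_op_natural i j : natural (skew_op i j).
Proof. by apply: opp_natural; apply: mscale_natural; apply: subst_natural. Qed.

Definition sesquir_op (p : poly1 R) := mapc (partial R) p + mul_X p.

Lemma sesquir_op_natural : natural sesquir_op.
Proof. exact: add_natural partial_natural mul_X_natural. Qed.

Lemma nij_sesquil a b : N (partial R a) b = - mul_X (N a b).
Proof.
rewrite /nijenhuis_bracket f_partial !(hlc_sesquil hR).
exact: nij_op (opp_natural mul_X_natural).
Qed.

Lemma nij_sesquir a b : N a (partial R b) = sesquir_op (N a b).
Proof.
rewrite /nijenhuis_bracket f_partial !(hlc_sesquir hR).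
exact: nij_op sesquir_op_natural.
Qed.

(** Skew-symmetry interchanges the terms [f a, b] and [a, f b]; the sign is the same for all three
    terms because [f] is even. *)
Lemma nij_skew i j (a b : R) : a \in part R i -> b \in part R j ->
  N a b = skew_op i j (N b a).
Proof.
move=> ai bj; have [fai fbj] := (f_even ai, f_even bj).
rewrite {1}/nijenhuis_bracket (hlc_skew hR fai bj) (hlc_skew hR ai fbj).
rewrite (hlc_skew hR ai bj) (nij_op _ _ _ (skew_op_natural i j)).
by rewrite [br b (f a) + _]addrC.
Qed.

Lemma nij_alpha a b : is_regular alpha br ->
  mapc alpha (N a b) = N (alpha a) (alpha b).
Proof.
have aD : is_add alpha by apply: linearD.
case=> _ br_alpha; rewrite (is_addB (mapcD aD)) (mapcD aD) !br_alpha -!f_alpha.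
rewrite /nijenhuis_bracket -br_alpha; congr (_ - _).
by apply: mapc_commute => // a'; rewrite f_alpha.
Qed.

(** * The deformed bracket B_t: Hom-Jacobi identity, remaining axioms, triviality *)

Hypothesis nij : forall a b, br (f a) (f b) = mapc f (N a b).
Variable t : F.

(** B_t written directly in R[lambda], with no choice of a representing 2-cochain. *)
Definition nij_deformed a b : poly1 R := br a b + mscale t (N a b).
Local Notation D := nij_deformed.

Lemma mul_lambda_natural : coef_natural (@mul_lambda R).
Proof. exact: coef_natural_mapk. Qed.

Lemma mul_mu_natural : coef_natural (@mul_mu R).
Proof. exact: coef_natural_mapk. Qed.

Lemma nest_deform_r L1 L2 u b c : coef_natural L1 -> coef_natural L2 ->
  nest L1 L2 (D u) (D b c) =
  deform_expand (mscale t) (mapc f) (nest L1 L2 (br u) (br b c))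
    (nest L1 L2 (br (f u)) (br b c) + nest L1 L2 (br u) (br (f b) c)
     + nest L1 L2 (br u) (br b (f c)))
    (nest L1 L2 (br (f u)) (br (f b) c) + nest L1 L2 (br (f u)) (br b (f c))
     + nest L1 L2 (br u) (br (f b) (f c))).
Proof.
move=> nL1 nL2.
exact: (nest_deform nL1 nL2 br_addr br_scaler nij t u (esym (nij b c))).
Qed.

(** The bracket [[a b] u] is a [nest] for the flipped bracket, which satisfies the flipped Nijenhuis
    identity. *)
Lemma nest_deform_l L1 L2 u a b : coef_natural L1 -> coef_natural L2 ->
  nest L1 L2 (D^~ u) (D a b) =
  deform_expand (mscale t) (mapc f) (nest L1 L2 (br^~ u) (br a b))
    (nest L1 L2 (br^~ (f u)) (br a b) + nest L1 L2 (br^~ u) (br (f a) b)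
     + nest L1 L2 (br^~ u) (br a (f b)))
    (nest L1 L2 (br^~ (f u)) (br (f a) b) + nest L1 L2 (br^~ (f u)) (br a (f b))
     + nest L1 L2 (br^~ u) (br (f a) (f b))).
Proof.
move=> nL1 nL2.
have brZ c u' v := br_scalel c v u'.
have nij' u' v :
    br (f v) (f u') = mapc f (nij_expand (fun u v => br v u) f u' v).
  by rewrite -nij_flipE nij.
have := nest_deform nL1 nL2 br_addl brZ nij' t u (esym (nij a b)).
apply: etrans; apply: eq_subst => v.
by rewrite /nij_deformed nij_flipE.
Qed.

Lemma nij_deformed_jacobi i j (a b c : R) :
  a \in part R i -> b \in part R j ->
  nest (@mul_mu R) (@mul_lambda R) (D (alpha a)) (D b c) =
  nest (@mul_lambda R) (fun p => mul_lambda p + mul_mu p)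
    (D^~ (alpha c)) (D a b)
  + mscale (koszul F i j)
      (nest (@mul_lambda R) (@mul_mu R) (D (alpha b)) (D a c)).
Proof.
move=> ai bj; have [nla nmu] := (mul_lambda_natural, mul_mu_natural).
rewrite (nest_deform_r _ _ _ nmu nla) (nest_deform_r _ _ _ nla nmu).
(* Commuting [f] past [alpha] turns the shifted outer brackets into the same iterated brackets at
   [f a], [f b] or [f c]. *)
rewrite (nest_deform_l _ _ _ nla (coef_natural_add nla nmu)) !f_alpha.
exact: (deform_expand_identity (f := f)
  (P := fun a => a \in part R i) (Q := fun b => b \in part R j)
  (J1 := fun a b c => nest (@mul_mu R) (@mul_lambda R) (br (alpha a)) (br b c))
  (J2 := fun a b c => nest (@mul_lambda R) (fun p => mul_lambda p + mul_mu p)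
    (br^~ (alpha c)) (br a b))
  (J3 := fun a b c => nest (@mul_lambda R) (@mul_mu R) (br (alpha b)) (br a c))
  (mscaleDr t) (mapcD fD) (mscaleDr (koszul F i j))
  (mscaleC t _) (mapc_mscale f _) (@f_even i) (@f_even j)
  (fun a b c ai bj => hlc_jacobi hR c ai bj) c ai bj).
Qed.

Lemma nij_deformed_parity i j (a b : R) : a \in part R i -> b \in part R j ->
  D a b \is a monalgOver (part R (i (+) j)).
Proof.
move=> ai bj; apply/monalgOverP => k; rewrite mcoeffD mcoeff_mscale.
apply: rpredD; first by move: k; apply/monalgOverP; apply: (hlc_parity hR).
by apply: rpredZ; move: k; apply/monalgOverP; apply: nij_parity.
Qed.

Lemma nij_deformed_hom_lie : is_hom_lie_conformal alpha D.
Proof.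
have linD (x y x' y' : poly1 R) c :
  mscale c x + y + mscale t (mscale c x' + y') =
  mscale c (x + mscale t x') + (y + mscale t y').
  by rewrite !mscaleDr (mscaleC t) addrACA.
split.
- exact: (hlc_alpha_even hR).
- exact: (hlc_alpha_partial hR).
- by move=> c a a' b; rewrite /nij_deformed (hlc_bilinl hR) nij_bilinl linD.
- by move=> c a b b'; rewrite /nij_deformed (hlc_bilinr hR) nij_bilinr linD.
- exact: nij_deformed_parity.
- move=> a b; rewrite /nij_deformed (hlc_sesquil hR) nij_sesquil.
  exact: deform_op (opp_natural mul_X_natural).
- move=> a b; rewrite /nij_deformed (hlc_sesquir hR) nij_sesquir.
  exact: deform_op sesquir_op_natural.
- move=> i j a b ai bj; rewrite {1}/nij_deformed (nij_skew ai bj).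
  rewrite (hlc_skew hR ai bj); exact: deform_op (skew_op_natural i j).
exact: nij_deformed_jacobi.
Qed.

Lemma nij_deformed_trivial a b :
  mapc (fun v => v + t *: f v) (D a b) = br (a + t *: f a) (b + t *: f b).
Proof.
have mapT (p : poly1 R) :
    mapc (fun v => v + t *: f v) p = p + mscale t (mapc f p).
  apply/malgP => k; rewrite mcoeffD mcoeff_mscale !mcoeff_mapc // => x y.
  by rewrite linearD scalerDr addrACA.
(* The Nijenhuis identity, read backwards, puts [f a, f b] at order t^2. *)
rewrite mapT /nij_deformed (mapcD fD) mapc_mscale -nij.
rewrite (br_addl (b + t *: f b)) /= br_scalel !br_addr !br_scaler.
exact: is_add_regroup (mscaleDr t) _ _ _ _ _.
Qed.

End NijenhuisBracket.

Lemma reindex_over (K L : choiceType) (V : zmodType) (S : addrClosed V)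
    (h : K -> L) (p : {malg V[K]}) :
  p \is a monalgOver S -> reindex h p \is a monalgOver S.
Proof.
move/monalgOverP=> pS; apply/monalgOverP => l.
rewrite (big_morph (mcoeff l) (mcoeffD l) (mcoeff0 l)).
by apply: rpred_sum => k _; rewrite mcoeffU rpredMn.
Qed.

(** * Reduction modulo partial + lambda + mu *)

Section Reduction.
Variables (F : fieldType) (R : superModule F).
Implicit Types (p q : poly2 R) (r : poly1 R).

Let partialD : is_add (partial R). Proof. exact: linearD. Qed.
Let mul_XD : is_add (@mul_X R). Proof. exact: mapkD. Qed.
Let negD : is_add (@neg_X_partial F R).
Proof. by case: (neg_X_partial_natural R). Qed.

Lemma mul_lambdaD : is_add (@mul_lambda R).
Proof. exact: mapkD. Qed.

Lemma mul_muD : is_add (@mul_mu R).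
Proof. exact: mapkD. Qed.

Lemma mul_lambdaU i j v :
  mul_lambda << v *g (i, j) >> = << v *g (i.+1, j) >> :> poly2 R.
Proof. exact: mapkU. Qed.

Lemma mul_muU i j v :
  mul_mu << v *g (i, j) >> = << v *g (i, j.+1) >> :> poly2 R.
Proof. exact: mapkU. Qed.

Lemma mul_lambda_mul_mu p : mul_lambda (mul_mu p) = mul_mu (mul_lambda p).
Proof.
move: p; apply: malg_morph_eq => [p q|p q|[i j] v].
- by rewrite mul_muD mul_lambdaD.
- by rewrite mul_lambdaD mul_muD.
by rewrite !(mul_muU, mul_lambdaU).
Qed.

Lemma neg_X_partial_mul_X r :
  neg_X_partial (mul_X r) = mul_X (neg_X_partial r).
Proof.
rewrite /neg_X_partial (is_addB mul_XD) (is_addN mul_XD).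
by rewrite [mapc _ (mul_X r)](mapc_mapk _ _ partialD).
Qed.

Lemma reduceD : is_add (@reduce F R).
Proof.
apply: (msumD (h := fun k v =>
  iter k.1 (@mul_X R) (iter k.2 (@neg_X_partial F R) (const1 v)))) => k v w.
by rewrite /const1 monalgUD !is_add_iter.
Qed.

Lemma reduceU i j v : reduce << v *g (i, j) >> =
  iter i (@mul_X R) (iter j (@neg_X_partial F R) (const1 v)).
Proof.
apply: (msumU (h := fun k v =>
  iter k.1 (@mul_X R) (iter k.2 (@neg_X_partial F R) (const1 v)))) => k.
by rewrite /const1 monalgU0 !(is_add0 (is_add_iter _ _)).
Qed.

(* The 2-cochain representing a bracket has no mu: any lift works, since the
   cochain identities are only required modulo partial + lambda + mu. *)
Definition in_lambda : poly1 R -> poly2 R := reindex (fun n => (n, 0%N)).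

Lemma in_lambdaD : is_add in_lambda.
Proof. exact: reindexD. Qed.

Lemma iter_mul_X n v : iter n (@mul_X R) (const1 v) = << v *g n >>.
Proof. by elim: n => //= n ->; apply: mapkU. Qed.

Lemma in_lambdaK : cancel in_lambda (@reduce F R).
Proof.
apply: malg_morph_eq => [p q|//|n v]; first by rewrite in_lambdaD reduceD.
by rewrite /in_lambda reindexU reduceU iter_mul_X.
Qed.

Lemma reduce_mul_mu p : reduce (mul_mu p) = neg_X_partial (reduce p).
Proof.
move: p; apply: malg_morph_eq => [p q|p q|[i j] v].
- by rewrite mul_muD reduceD.
- by rewrite reduceD negD.
rewrite mul_muU !reduceU /=; elim: i => //= i ->.
by rewrite neg_X_partial_mul_X.
Qed.

Lemma reduce_mul_lambda p : reduce (mul_lambda p) = mul_X (reduce p).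
Proof.
move: p; apply: malg_morph_eq => [p q|p q|[i j] v].
- by rewrite mul_lambdaD reduceD.
- by rewrite reduceD mul_XD.
by rewrite mul_lambdaU !reduceU.
Qed.

Lemma mul_lambda_in_lambda r : mul_lambda (in_lambda r) = in_lambda (mul_X r).
Proof.
move: r; apply: malg_morph_eq => [p q|p q|n v].
- by rewrite in_lambdaD mul_lambdaD.
- by rewrite mul_XD in_lambdaD.
by rewrite /in_lambda reindexU mul_lambdaU /mul_X mapkU reindexU.
Qed.

(** The swap sends lambda^n to mu^n, which reduces to (-lambda - partial)^n; two-variable
    skew-symmetry thus becomes the one-variable axiom. *)
Lemma reduce_swap_in_lambda r : reduce (swap_vars (in_lambda r)) =
  subst (@neg_X_partial F R) (@const1 R) r.
Proof.
have cD : is_add (@const1 R) by exact: monalgUD.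
move: r; apply: malg_morph_eq => [p q||n v].
- by rewrite in_lambdaD /swap_vars mapkD reduceD.
- exact: substD.
by rewrite /in_lambda reindexU /swap_vars mapkU reduceU substU.
Qed.

Definition total p := mapc (partial R) p + mul_lambda p + mul_mu p.

Lemma totalD : is_add total.
Proof.
move=> p q; rewrite /total (mapcD partialD) mul_lambdaD mul_muD.
by rewrite [X in X + _ = _]addrACA [LHS]addrACA.
Qed.

Lemma total_mul_mu p : mul_mu (total p) = total (mul_mu p).
Proof.
rewrite /total !mul_muD [mapc _ (mul_mu p)](mapc_mapk _ _ partialD).
by rewrite mul_lambda_mul_mu.
Qed.

Lemma total_mul_lambda p : mul_lambda (total p) = total (mul_lambda p).
Proof.
rewrite /total !mul_lambdaD [mapc _ (mul_lambda p)](mapc_mapk _ _ partialD).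
by rewrite mul_lambda_mul_mu.
Qed.

(** Division with remainder: partial + lambda + mu is monic of degree one in mu, and the remainder
    is free of mu. On monomials, induction runs first on the exponent of mu, then on that of lambda,
    where the quotient is just multiplied by lambda. *)
Lemma eqmod_total_in_lambda p : eqmod_total p (in_lambda (reduce p)).
Proof.
rewrite (monalgE p).
elim/big_ind: _ => [|p1 p2 [q1 e1] [q2 e2]|[i j] _].
- exists 0; rewrite !(is_add0 reduceD, is_add0 in_lambdaD) subrr.
  by rewrite -/(total 0) (is_add0 totalD).
- exists (q1 + q2); rewrite -/(total _) totalD -/(total q1) -/(total q2).
  by rewrite reduceD in_lambdaD opprD addrACA e1 e2.
move: (p@_(i, j)) => v; elim: i => [|i [q IHi]].
  elim: j => [|j [q IHj]].
    exists 0; rewrite -/(total 0) (is_add0 totalD).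
    by rewrite reduceU /in_lambda reindexU subrr.
  set m := << v *g (0%N, j) >> in IHj.
  (* If m = r + [total q] with r free of mu, then mu m = mu r + [total (mul_mu q)], and mu r =
     [total r] - (partial + lambda) r; hence the extra summand r in the quotient. *)
  exists (mul_mu q + in_lambda (reduce m)); rewrite -/(total _) totalD.
  rewrite -total_mul_mu /total -IHj.
  rewrite -(mul_muU 0 j v) -/m reduce_mul_mu (is_addB mul_muD).
  rewrite /neg_X_partial (is_addB in_lambdaD) (is_addN in_lambdaD).
  rewrite -mul_lambda_in_lambda /in_lambda -mapc_reindex // -/in_lambda.
  move: (mul_mu m) (mul_mu (in_lambda _)) (mul_lambda _) (mapc _ _) => w u l d.
  by rewrite opprD !opprK [_ + u]addrC [RHS]addrA subrK [d + l]addrC.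
exists (mul_lambda q); rewrite -/(total _) -total_mul_lambda /total -IHi.
by rewrite -mul_lambdaU reduce_mul_lambda -mul_lambda_in_lambda
  (is_addB mul_lambdaD).
Qed.

(** Both sides are congruent to the same remainder. This reduces each 2-cochain identity to one in
    R[lambda]. *)
Lemma reduce_eqmod_total p q : reduce p = reduce q -> eqmod_total p q.
Proof.
move=> eq_pq; have [[u eu] [v ev]] :=
  (eqmod_total_in_lambda p, eqmod_total_in_lambda q).
exists (u - v); rewrite -/(total _) (is_addB totalD) -/(total u) -/(total v).
by rewrite /total -eu -ev eq_pq opprB addrA subrK.
Qed.

End Reduction.

(** * The Nijenhuis bracket as an even 2-cochain *)

Section NijenhuisCochain.
Variables (F : fieldType) (R : superModule F) (alpha f : {linear R -> R}).
Variable br : R -> R -> poly1 R.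
Hypotheses (hR : is_hom_lie_conformal alpha br) (hreg : is_regular alpha br).
Hypotheses (f_even : even_op f) (f_cochain : cochain1 alpha f).
Local Notation N := (nijenhuis_bracket br f).

Let f_partial : forall a, f (partial R a) = partial R (f a).
Proof. by case: f_cochain. Qed.

Lemma nij_cochain2 : even_cochain2 alpha (fun a b => in_lambda (N a b)).
Proof.
have alphaD : is_add alpha by apply: linearD.
have mscale_in t (r : poly1 R) :
    mscale t (in_lambda r) = in_lambda (mscale t r).
  by apply: mapc_reindex; apply: scale_add.
split; last first.
  by move=> i j a b ai bj; apply/reindex_over/(nij_parity hR f_even).
split.
- by move=> c a a' b; rewrite (nij_bilinl f hR) in_lambdaD mscale_in.
- by move=> c a b b'; rewrite (nij_bilinr f hR) in_lambdaD mscale_in.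
- move=> a b; apply: reduce_eqmod_total; rewrite (is_addN (@reduceD _ _)).
  by rewrite reduce_mul_lambda !in_lambdaK (nij_sesquil hR f_partial).
- move=> a b; apply: reduce_eqmod_total; rewrite (is_addN (@reduceD _ _)).
  (* Here -mu reduces to partial + lambda, the factor in the sesquilinearity of N on the right. *)
  rewrite reduce_mul_mu !in_lambdaK (nij_sesquir hR f_partial).
  by rewrite /neg_X_partial opprD !opprK addrC.
- move=> i j a b ai bj; apply: reduce_eqmod_total.
  rewrite in_lambdaK (nij_skew hR f_even f_partial ai bj).
  rewrite (is_addN (@reduceD _ _)).
  have -> c p : mscale c (swap_vars p) = swap_vars (mscale c p) :> poly2 R.
    by apply: mapc_mapk; apply: scale_add.
  rewrite mscale_in reduce_swap_in_lambda /skew_op.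
  (* Naturality with respect to scalings moves the Koszul sign through the substitution. *)
  have [_ substg] := subst_natural R.
  by rewrite /mscale (substg _ (scale_conformal R _)).
have [_ f_alpha] := f_cochain.
move=> a b; apply: reduce_eqmod_total.
rewrite (mapc_reindex _ _ alphaD) !in_lambdaK.
exact/esym/(nij_alpha f_alpha _ _ hreg).
Qed.

End NijenhuisCochain.

(** * Existence of the cochain, the deformation and its triviality *)

Local Open Scope complex_scope.

(** The formula for the Nijenhuis bracket fixes only the reduction of [psi]; hence existence of a
    representative is one claim, and the conclusions are drawn for every representative. *)
Theorem theorem3p4 (RR : realType) (R : superModule RR[i])
    (alpha : {linear R -> R}) (br : R -> R -> poly1 R)
    (hR : is_hom_lie_conformal alpha br) (hreg : is_regular alpha br)
    (f : {linear R -> R}) (f_even : even_op f)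
    (hf : hom_nijenhuis alpha br f) :
  (exists psi : R -> R -> poly2 R,
     even_cochain2 alpha psi /\
     forall a b, reduce (psi a b) = nijenhuis_bracket br f a b) /\
  (forall psi : R -> R -> poly2 R,
     even_cochain2 alpha psi ->
     (forall a b, reduce (psi a b) = nijenhuis_bracket br f a b) ->
     generates_deformation alpha br psi /\ trivial_deformation alpha br psi).
Proof.
have [f_cochain nij] := hf; have [f_partial f_alpha] := f_cochain.
split=> [|psi _ psiE].
  exists (fun a b => in_lambda (nijenhuis_bracket br f a b)).
  by split=> [|a b]; [exact: nij_cochain2 | exact: in_lambdaK].
(* The deformed bracket depends on [psi] only through its reduction, so it equals B_t. *)
have deformedE t : deformed br psi t = nij_deformed f br t.
  by apply/funext => a; apply/funext => b; rewrite /deformed psiE.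
split=> [t|].
  by rewrite deformedE; apply: nij_deformed_hom_lie.
exists f; split=> // t a b.
by rewrite deformedE; apply: (nij_deformed_trivial hR).
Qed.
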